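(* Let $d \ge 0$ be an integer and let $\mathcal{A}, \mathcal{B} \subseteq \mathbb{R}^d$ be two sets, each of which linearly spans $\mathbb{R}^d$, such that $\langle a, b\rangle \in \{0,1\}$ holds for all $a \in \mathcal{A}$ and $b \in \mathcal{B}$. Then $|\mathcal{A}| \cdot |\mathcal{B}| \le (d+1)\, 2^d$.
   Context: For $a = (a_1,\ldots,a_d)$ and $b = (b_1,\ldots,b_d)$ in $\mathbb{R}^d$, $\langle a, b\rangle = \sum_{i=1}^d a_i b_i$ denotes the standard scalar product. *)

(* Defs.v *)
From HB Require Import structures.
From mathcomp Require Import all_boot all_order all_algebra.
From mathcomp Require Import finmap boolp classical_sets cardinality reals.

Set Implicit Arguments.
Unset Strict Implicit.
Unset Printing Implicit Defensive.

Import GRing.Theory.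
Local Open Scope classical_set_scope.
Local Open Scope ring_scope.

Definition scalar_product (R : realType) (d : nat) (a b : 'rV[R]_d) : R :=
  \sum_(i < d) a ord0 i * b ord0 i.

(* The library spans only finite sequences; [A] may be infinite here, so its
   span is the set of linear combinations of finitely many elements of [A]. *)
Definition linear_span (R : realType) (d : nat) (A : set 'rV[R]_d) :
    set 'rV[R]_d :=
  [set v | exists2 s : seq 'rV[R]_d, [set` s] `<=` A & v \in <<s>>%VS].

(* Main.v *)
(* Induction on d, for families of vectors that separate each other and contain
   0.  Choose a hyperplane n^⊥ with at least half of the a_i on it (the set Z),
   containing as many a_i as possible; let K be the remaining a_i.  Projecting
   the b_j to n^⊥ has fibres of size at most 2; let X be the number of
   fibres of size 2, and P the number of all fibres.  By induction
   |Z| P <= d 2^(d-1).  By maximality of Z the members of every double fibre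
   differ by the same vector, hence agree up to complementation on K, which
   gives |K| X <= 2^(d-1).  Since |K| <= |Z| and X <= P,
   (|Z| + |K|) (P + X) <= 2 |Z| P + 2 |K| X <= (d + 1) 2^d. *)
Require Import Defs.
From mathcomp Require Import all_boot all_order all_algebra.
From mathcomp Require Import finmap boolp classical_sets cardinality reals.
From mathcomp Require Import zify ring lra.

Set Implicit Arguments.
Unset Strict Implicit.
Unset Printing Implicit Defensive.

Import Order.TTheory GRing.Theory Num.Theory.
Local Open Scope ring_scope.

(** * Scalar products of row vectors *)

Section Dot.
Variables (F : realFieldType) (d : nat).
Implicit Types (u v w : 'rV[F]_d) (c : F).

Definition dot u v : F := (u *m v^T) 0 0.

Lemma dotC u v : dot u v = dot v u.
Proof. by rewrite /dot !mxE; apply: eq_bigr => i _; rewrite !mxE mulrC. Qed.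

Lemma dotBl u v w : dot (u - v) w = dot u w - dot v w.
Proof. by rewrite /dot mulmxBl !mxE. Qed.

Lemma dotBr u v w : dot u (v - w) = dot u v - dot u w.
Proof. by rewrite ![dot u _]dotC dotBl. Qed.

Lemma dotZl c u v : dot (c *: u) v = c * dot u v.
Proof. by rewrite /dot -scalemxAl mxE. Qed.

Lemma dotZr c u v : dot u (c *: v) = c * dot u v.
Proof. by rewrite ![dot u _]dotC dotZl. Qed.

Lemma dot0l u : dot 0 u = 0.
Proof. by rewrite /dot mul0mx mxE. Qed.

Lemma dot0r u : dot u 0 = 0.
Proof. by rewrite dotC dot0l. Qed.

Lemma dot_kermx u v : (dot u v == 0) = (u <= kermx v^T)%MS.
Proof.
apply/eqP/sub_kermxP => [uv0|]; last by rewrite /dot => ->; rewrite mxE.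
by apply/rowP => i; rewrite !ord1 [RHS]mxE.
Qed.

(** * Counting families with binary products, and choosing hyperplanes *)

Definition binary (x : F) := x = 0 \/ x = 1.

Definition separated (S T : finType) (I : {set S}) (J : {set T})
    (a : S -> 'rV[F]_d) (b : T -> 'rV[F]_d) :=
  forall i i', i \in I -> i' \in I ->
    (forall j, j \in J -> dot (a i) (b j) = dot (a i') (b j)) -> i = i'.

(** Induction on the rank of [L]: a column that distinguishes two rows splits [I] by its values 0
    and 1, and differences within each class lie in a proper subspace of [L]. *)
Lemma card_separated_le (S T : finType) (I : {set S}) (J : {set T})
    (a : S -> 'rV[F]_d) (b : T -> 'rV[F]_d) (L : 'M[F]_d) :
    (forall i j, i \in I -> j \in J -> binary (dot (a i) (b j))) ->
    separated I J a b ->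
    (forall i i', i \in I -> i' \in I -> (a i - a i' <= L)%MS) ->
  (#|I| <= 2 ^ \rank L)%N.
Proof.
have [k] := ubnP (\rank L); elim: k I L => // k IH I L leLk bin sep aL.
have [I1|/card_gt1P[i [i' [iI i'I ii']]]] := leqP #|I| 1.
  by rewrite (leq_trans I1) // expn_gt0.
have [[j jJ ab]|noj] :=
  pselect (exists2 j, j \in J & dot (a i) (b j) != dot (a i') (b j)); last first.
  case/eqP: ii'; apply: sep => // j jJ; apply/eqP/negPn/negP => ab.
  by apply: noj; exists j.
pose L' := (L :&: kermx (b j)^T)%MS.
have ltL : (\rank L' < \rank L)%N.
  apply: rank_ltmx; rewrite /ltmx capmxSl; apply: contra ab => LL'.
  rewrite -subr_eq0 -dotBl dot_kermx.
  by apply: submx_trans (aL _ _ iI i'I) (submx_trans LL' (capmxSr _ _)).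
have half c : (#|[set i in I | dot (a i) (b j) == c]| <= 2 ^ \rank L')%N.
  apply: IH; first by rewrite (leq_trans ltL).
  - by move=> x y; rewrite inE => /andP[xI _]; apply: bin.
  - by move=> x y; rewrite !inE => /andP[xI _] /andP[yI _]; apply: sep.
  - move=> x y; rewrite !inE => /andP[xI /eqP xc] /andP[yI /eqP yc].
    by rewrite sub_capmx aL //= -dot_kermx dotBl xc yc subrr.
have -> : I = [set i in I | dot (a i) (b j) == 0]
          :|: [set i in I | dot (a i) (b j) == 1].
  apply/setP => x; rewrite !inE; case xI: (x \in I) => //=.
  by case: (bin x j xI jJ) => ->; rewrite eqxx ?orbT.
apply: leq_trans (leq_card_setU _ _) _.
apply: leq_trans (leq_add (half 0) (half 1)) _.
by rewrite addnn -mul2n -expnS leq_exp2l.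
Qed.

(* Replacing b j by b j - b j0 and negating the a i with <a i, b j0> = 1 keeps
   all products binary and turns the columns in X into the constant 1 on K, so
   K lies on an affine hyperplane that misses the origin. *)
Lemma card_complementary_le (S T : finType) (I K : {set S}) (J X : {set T})
    (a : S -> 'rV[F]_d) (b : T -> 'rV[F]_d) (j0 z : T) :
    (forall i j, i \in I -> j \in J -> binary (dot (a i) (b j))) ->
    separated I J a b -> separated J I b a ->
    K \subset I -> X \subset J -> j0 \in J -> z \in J -> b z = 0 ->
    (forall i j, i \in K -> j \in X ->
       dot (a i) (b j) = 1 - dot (a i) (b j0)) ->
  (2 * (#|K| * #|X|) <= 2 ^ d)%N.
Proof.
move=> bin sepI sepJ /fintype.subsetP KI /fintype.subsetP XJ j0J zJ bz compl.
have [->|[i0 i0K]] := set_0Vmem K; first by rewrite cards0.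
have [->|[j1 j1X]] := set_0Vmem X; first by rewrite cards0 muln0.
pose a' i := (1 - dot (a i) (b j0) *+ 2) *: a i.
pose b' j := b j - b j0.
have ab' i j : i \in K -> j \in J ->
    (dot (a i) (b j0) = 0 /\ dot (a' i) (b' j) = dot (a i) (b j)) \/
    (dot (a i) (b j0) = 1 /\ dot (a' i) (b' j) = 1 - dot (a i) (b j)).
  move=> /KI iI jJ; rewrite /a' /b' dotZl dotBr.
  by case: (bin i j0 iI j0J) => ->; [left|right]; split=> //; ring.
have a'N i j : i \in K -> j \in X -> dot (a' i) (b' j) = 1.
  move=> iK jX; have := compl i j iK jX.
  by case: (ab' i j iK (XJ _ jX)) => -[-> ->] ->; ring.
(* [G] is the span of the [a' i] and [D] the direction space of their affine hull. The hull misses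
   the origin, so [D] has smaller rank. *)
pose D := (\sum_(i in K) <<a' i - a' i0>>)%MS.
pose G := (\sum_(i in K) <<a' i>>)%MS.
have a'G i : i \in K -> (a' i <= G)%MS.
  by move=> iK; apply: (sumsmx_sup i) => //; rewrite genmxE.
have a'D i : i \in K -> (a' i - a' i0 <= D)%MS.
  by move=> iK; apply: (sumsmx_sup i) => //; rewrite genmxE.
have ltDG : (\rank D < \rank G)%N.
  apply: rank_ltmx; rewrite /ltmx; apply/andP; split.
    by apply/sumsmx_subP => i iK; rewrite genmxE addmx_sub ?eqmx_opp ?a'G.
  apply/negP => GD.
  have : (a' i0 <= kermx (b' j1)^T)%MS.
    apply: submx_trans (a'G _ i0K) (submx_trans GD _).
    apply/sumsmx_subP => i iK; rewrite genmxE -dot_kermx dotBl.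
    by rewrite !a'N // subrr.
  by rewrite -dot_kermx a'N // oner_eq0.
have leK : (#|K| <= 2 ^ \rank D)%N.
  apply: (@card_separated_le _ _ K J a' b') => [i j iK jJ|i i' iK i'K E|i i' iK i'K].
  - have := bin i j (KI _ iK) jJ.
    by case: (ab' i j iK jJ) => -[_ ->] [] ->; rewrite /binary ?subr0 ?subrr; tauto.
  - apply: sepI => [||j jJ]; [exact: KI|exact: KI|].
    (* The zero column [z] yields the product [dot (a i) (b j0)] itself, which reveals whether [a i]
       was negated. *)
    have := E j jJ; have := E z zJ; rewrite /a' /b' bz sub0r.
    rewrite !dotZl !dotBr -scaleN1r !dotZr.
    case: (bin i j0 (KI _ iK) j0J) => ->; case: (bin i' j0 (KI _ i'K) j0J) => ->;
      move=> *; lra.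
  - have -> : a' i - a' i' = (a' i - a' i0) - (a' i' - a' i0).
      by rewrite opprB addrA subrK.
    by rewrite addmx_sub ?eqmx_opp ?a'D.
(* All columns in [X] have the same products with the rows in [K], so their differences are
   orthogonal to [G]. *)
have leX : (#|X| <= 2 ^ \rank (kermx G^T))%N.
  apply: (@card_separated_le _ _ X I b a) => [j i jX iI|j j' jX j'X|j j' jX j'X].
  - by rewrite dotC; apply: bin => //; apply: XJ.
  - by apply: sepJ; apply: XJ.
  - apply/sub_kermxP/trmx_inj; rewrite trmx_mul trmxK trmx0; apply/sub_kermxP.
    apply/sumsmx_subP => i iK; rewrite genmxE -dot_kermx dotZl dotBr.
    by rewrite (compl i j) // (compl i j') // subrr mulr0.
apply: (@leq_trans (2 * (2 ^ \rank D * 2 ^ \rank (kermx G^T)))).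
  by rewrite leq_mul2l leq_mul.
(* The strict inequality between the ranks of [D] and [G] pays for the factor 2. *)
rewrite -expnD -expnS leq_exp2l // mxrank_ker mxrank_tr.
by have := rank_leq_col G; lia.
Qed.

(** Descent on the number of rows off the hyperplane: a nonzero [m] that violates the last clause is
    orthogonal to strictly more rows and replaces the normal. *)
Lemma maximal_normal (S : finType) (I : {set S}) (a : S -> 'rV[F]_d)
    (n0 : 'rV[F]_d) : n0 != 0 ->
  exists n, [/\ n != 0,
    forall i, i \in I -> dot (a i) n0 = 0 -> dot (a i) n = 0 &
    forall m i, (forall i', i' \in I -> dot (a i') n = 0 -> dot (a i') m = 0) ->
      i \in I -> dot (a i) n != 0 -> dot (a i) m = 0 -> m = 0].
Proof.
have [k] := ubnP #|[set i in I | dot (a i) n0 != 0]|.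
elim: k n0 => // k IH n0 lek n0N0.
have [[m [i [Zm iI ni mi m0]]]|max] := pselect (exists m i,
    [/\ forall i', i' \in I -> dot (a i') n0 = 0 -> dot (a i') m = 0,
        i \in I, dot (a i) n0 != 0, dot (a i) m = 0 & m != 0]); last first.
  exists n0; split=> // m i Zm iI ni mi; apply/eqP/negPn/negP => m0.
  by apply: max; exists m, i.
have [] := IH m _ m0; last by move=> n [nN0 Zn nmax]; exists n; split; auto.
rewrite -ltnS (leq_trans _ lek) // ltnS proper_card //.
apply/properP; split; last by exists i; rewrite !inE ?iI ?ni // mi eqxx.
apply/fintype.subsetP => x; rewrite !inE => /andP[xI xm]; rewrite xI /=.
by apply: contra xm => /eqP/(Zm _ xI)->.
Qed.

End Dot.

(** The rows of [K] are a basis of the hyperplane, cast to exactly [d] rows so that coordinates in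
    it have dimension [d]. *)
Lemma hyperplane_coordinates (F : realFieldType) (d : nat) (n : 'rV[F]_d.+1) :
  n != 0 -> exists K : 'M[F]_(d, d.+1), forall u, dot u n = 0 -> (u <= K)%MS.
Proof.
move=> n0; have rK : \rank (kermx n^T) = d.
  by rewrite mxrank_ker mxrank_tr rank_rV n0 subn1.
exists (castmx (rK, erefl _) (row_base (kermx n^T))) => u /eqP.
by rewrite dot_kermx eqmx_cast eq_row_base.
Qed.

(** * The bound for finite binary systems, by induction on the dimension *)

Section Bound.
Variable F : realFieldType.

(** Separation takes the place of spanning because it survives the passage to a hyperplane. Indexed
    families let vectors be replaced while the index sets stay fixed. *)
Record binary_system (d : nat) (S T : finType) (I : {set S}) (J : {set T})
    (a : S -> 'rV[F]_d) (b : T -> 'rV[F]_d) : Prop := BinarySystem {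
  system_binary : forall i j, i \in I -> j \in J -> binary (dot (a i) (b j));
  system_row0 : exists2 i, i \in I & a i = 0;
  system_col0 : exists2 j, j \in J & b j = 0;
  system_rows : separated I J a b;
  system_cols : separated J I b a }.

Lemma system_card_le1 (d : nat) (S T : finType) (I : {set S}) (J : {set T})
    (a : S -> 'rV[F]_d) (b : T -> 'rV[F]_d) :
    binary_system I J a b ->
    (forall i j, i \in I -> j \in J -> dot (a i) (b j) = 0) ->
  (#|I| * #|J| <= 1)%N.
Proof.
move=> sys ab0; have I1 : (#|I| <= 1)%N.
  apply/card_le1_eqP => i i' iI i'I; apply: (system_rows sys) => // j jJ.
  by rewrite !ab0.
have J1 : (#|J| <= 1)%N.
  apply/card_le1_eqP => j j' jJ j'J; apply: (system_cols sys) => // i iI.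
  by rewrite ![dot (b _) _]dotC !ab0.
exact: leq_mul I1 J1.
Qed.

Definition system_bound (d : nat) := forall (S T : finType) (I : {set S})
  (J : {set T}) (a : S -> 'rV[F]_d) (b : T -> 'rV[F]_d),
  binary_system I J a b -> (#|I| * #|J| <= (d + 1) * 2 ^ d)%N.

(** Rows are written in a basis of the hyperplane, and columns are replaced by their products with
    that basis. This preserves all products, so the system lives in dimension [d]. *)
Lemma hyperplane_system_bound (d : nat) (S T : finType) (I : {set S})
    (J : {set T}) (a : S -> 'rV[F]_d.+1) (b : T -> 'rV[F]_d.+1)
    (n : 'rV[F]_d.+1) :
    system_bound d -> binary_system I J a b -> n != 0 ->
    (forall i, i \in I -> dot (a i) n = 0) ->
  (#|I| * #|J| <= (d + 1) * 2 ^ d)%N.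
Proof.
move=> IH [bin [i0 i0I ai0] [j0 j0J bj0] rows cols] n0 an.
have [K KP] := hyperplane_coordinates n0.
pose a' i := a i *m pinvmx K; pose b' j := b j *m K^T.
have ab' i j : i \in I -> dot (a' i) (b' j) = dot (a i) (b j).
  move=> iI; rewrite /dot /a' /b' trmx_mul trmxK mulmxA mulmxKpV //.
  exact: KP (an i iI).
apply: (IH _ _ I J a' b'); split.
- by move=> i j iI jJ; rewrite ab' //; apply: bin.
- by exists i0 => //; rewrite /a' ai0 mul0mx.
- by exists j0 => //; rewrite /b' bj0 mul0mx.
- move=> i i' iI i'I E; apply: rows => // j jJ.
  by rewrite -!ab' //; apply: E.
- move=> j j' jJ j'J E; apply: cols => // i iI.
  by rewrite ![dot (b _) _]dotC -!ab' // ![dot (a' _) _]dotC; apply: E.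
Qed.

Lemma majority_system_bound (d : nat) (S T : finType) (I : {set S})
    (J : {set T}) (a : S -> 'rV[F]_d.+1) (b : T -> 'rV[F]_d.+1)
    (n0 : 'rV[F]_d.+1) :
    system_bound d -> binary_system I J a b -> n0 != 0 ->
    (#|[set i in I | dot (a i) n0 != 0%R]| <=
       #|[set i in I | dot (a i) n0 == 0%R]|)%N ->
  (#|I| * #|J| <= (d.+1 + 1) * 2 ^ d.+1)%N.
Proof.
move=> IH sys n0N0 le0.
have [n [nN0 n0n nmax]] := maximal_normal I a n0N0.
(* By maximality of the hyperplane, a column is determined by its products with the rows on it and
   with any single row off it. *)
have bN0 (i : S) (j j' : T) : i \in I -> j \in J -> j' \in J ->
    dot (a i) n != 0 -> dot (a i) (b j) = dot (a i) (b j') ->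
    (forall i', i' \in I -> dot (a i') n = 0 ->
      dot (a i') (b j) = dot (a i') (b j')) -> j = j'.
  move=> iI jJ j'J ni Ei EZ; have b0 : b j - b j' = 0.
    apply: (nmax _ i) => //; last by rewrite dotBr Ei subrr.
    by move=> i' i'I /(EZ _ i'I) E; rewrite dotBr E subrr.
  by apply: (system_cols sys) => // x _; rewrite (subr0_eq b0).
pose Z := [set i in I | dot (a i) n == 0].
pose K := [set i in I | dot (a i) n != 0].
have cardI : #|I| = (#|Z| + #|K|)%N.
  rewrite -(cardsID [set i | dot (a i) n == 0] I); congr addn.
    by apply: eq_card => i; rewrite !inE.
  by apply: eq_card => i; rewrite !inE andbC.
have leKZ : (#|K| <= #|Z|)%N.
  apply: leq_trans (leq_trans le0 _); apply: subset_leq_card.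
    apply/fintype.subsetP => i; rewrite !inE => /andP[iI ni]; rewrite iI.
    by apply: contra ni => /eqP/(n0n _ iI)->.
  apply/fintype.subsetP => i; rewrite !inE => /andP[iI /eqP ni]; rewrite iI.
  by rewrite (n0n _ iI ni) /=.
have ZP i : i \in Z -> i \in I /\ dot (a i) n = 0.
  by rewrite inE => /andP[iI /eqP].
have [K0|[k kK]] := set_0Vmem K.
  have : (#|I| * #|J| <= (d + 1) * 2 ^ d)%N.
    apply: (hyperplane_system_bound IH sys nN0) => i iI.
    by have /setP/(_ i) := K0; rewrite !inE iI /= => /negbT; rewrite negbK => /eqP.
  move=> /leq_trans; apply; rewrite leq_mul ?leq_exp2l //; lia.
have [kI kn] : k \in I /\ dot (a k) n != 0 by move: kK; rewrite inE => /andP.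
have [bin [i0 i0I ai0] [z zJ bz] rows cols] := sys.
pose sameZ (j j' : T) := [forall i in Z, dot (a i) (b j) == dot (a i) (b j')].
have sameZP j j' : reflect
    (forall i, i \in I -> dot (a i) n = 0 -> dot (a i) (b j) = dot (a i) (b j'))
    (sameZ j j').
  apply: (iffP 'forall_in_eqP) => E i; last by case/ZP; apply: E.
  by move=> iI /eqP ni; apply: E; rewrite inE iI.
(* Columns that agree on [Z] form a fibre, with at most one member for each value on [k]. [X] takes
   the member of value 1 from each double fibre, so [J :\: X] keeps one column per fibre. *)
pose partner j := [pick j' in J | (dot (a k) (b j') == 0) && sameZ j j'].
pose X := [set j in J | (dot (a k) (b j) == 1) && (partner j != None)].
have XP j : j \in X -> exists j', [/\ j \in J, j' \in J,
    dot (a k) (b j) = 1, dot (a k) (b j') = 0 & sameZ j j'].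
  rewrite inE /partner => /and3P[jJ /eqP j1]; case: pickP => // j'.
  by case/and3P => j'J /eqP j'0 jj' _; exists j'.
have XJ : X \subset J by apply/fintype.subsetP => j; rewrite inE => /andP[].
have cardJ : #|J| = (#|J :\: X| + #|X|)%N.
  by rewrite -(cardsID X J) addnC (finset.setIidPr XJ).
have leXJ : (#|X| <= #|J :\: X|)%N.
  (* Sending a column to its partner maps [X] injectively into [J :\: X]; the default [j] never
     occurs on [X]. *)
  rewrite -(card_in_imset (f := fun j => odflt j (partner j)) (D := mem X)).
    apply: subset_leq_card; apply/fintype.subsetP => _ /imsetP[j + ->].
    rewrite !inE /partner => /and3P[jJ _]; case: pickP => // j'.
    by case/and3P => -> /eqP-> _ _; rewrite eq_sym oner_eq0 andbF.
  move=> j1 j2; rewrite !inE /partner => /and3P[j1J /eqP m1] + /and3P[j2J /eqP m2].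
  case: pickP => // j1' /and3P[_ _ /sameZP s1] _.
  case: pickP => // j2' /and3P[_ _ /sameZP s2] _ /= E.
  apply: (bN0 k) => //; first by rewrite m1 m2.
  by move=> i iI ni; rewrite s1 // s2 // E.
have sysZ : binary_system Z (J :\: X) a b.
  split.
  - by move=> i j /ZP[iI _] /finset.setDP[jJ _]; apply: bin.
  - by exists i0 => //; rewrite inE i0I ai0 dot0l eqxx.
  - exists z => //; rewrite inE zJ andbT inE bz dot0r zJ.
    by rewrite eq_sym oner_eq0.
  - move=> i i' /ZP[iI ni] /ZP[i'I ni'] E; apply: rows => // j jJ.
    (* A column in [X] may be replaced by its partner, which lies outside [X] and has the same
       products on [Z]. *)
    have [jX|jX] := boolP (j \in X); last by apply: E; rewrite inE jX.
    have [j' [_ j'J _ j'0 /sameZP jj']] := XP j jX.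
    rewrite !jj' //; apply: E; rewrite inE j'J andbT inE j'0.
    by rewrite eq_sym oner_eq0 andbF.
  - move=> j j' /finset.setDP[jJ jX] /finset.setDP[j'J j'X] E.
    have jj' i : i \in I -> dot (a i) n = 0 -> dot (a i) (b j) = dot (a i) (b j').
      move=> iI ni; rewrite ![dot (a _) _]dotC; apply: E.
      by rewrite inE iI ni eqxx.
    have noX (x y : T) : x \in J -> y \in J -> dot (a k) (b x) = 1 ->
        dot (a k) (b y) = 0 ->
        (forall i, i \in I -> dot (a i) n = 0 -> dot (a i) (b x) = dot (a i) (b y)) ->
        x \in X.
      move=> xJ yJ x1 y0 /sameZP xy; rewrite inE xJ x1 eqxx /= /partner.
      by case: pickP => // /(_ y); rewrite yJ y0 eqxx xy.
    apply: (bN0 k) => //.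
    have [y0|y1] := bin k j kI jJ; have [y0'|y1'] := bin k j' kI j'J.
    + by rewrite y0 y0'.
    + case/negP: j'X; apply: (noX _ j) => // i iI ni; by rewrite jj'.
    + case/negP: jX; exact: (noX _ j').
    + by rewrite y1 y1'.
have leZ : (#|Z| * #|J :\: X| <= (d + 1) * 2 ^ d)%N.
  by apply: (hyperplane_system_bound IH sysZ nN0) => i /ZP[].
have leK : (2 * (#|K| * #|X|) <= 2 ^ d.+1)%N.
  have [->|[j1 j1X]] := set_0Vmem X; first by rewrite cards0 muln0.
  have [j0 [j1J j0J m1 m0 /sameZP s10]] := XP j1 j1X.
  apply: (card_complementary_le bin rows cols _ XJ j0J zJ bz) => [|i j].
    by apply/fintype.subsetP => i; rewrite inE => /andP[].
  rewrite inE => /andP[iI ni] jX.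
  have [j' [jJ j'J m m' /sameZP sjj']] := XP j jX.
  (* Both differences vanish on [Z] and equal 1 on [k], so maximality identifies them. *)
  have diff : (b j - b j') - (b j1 - b j0) = 0.
    apply: (nmax _ k) => //; last by rewrite !dotBr m m' m1 m0 subrr.
    by move=> x xI nx; rewrite !dotBr sjj' // s10 // !subrr.
  have neq : dot (a i) (b j1) <> dot (a i) (b j0).
    move=> E; have E10 := bN0 i j1 j0 iI j1J j0J ni E s10.
    by move: m1; rewrite E10 m0 => /eqP; rewrite eq_sym oner_eq0.
  (* The right side is 1 or -1 by [neq]; an equal difference of binary numbers forces
     [dot (a i) (b j)] to equal [dot (a i) (b j1)]. *)
  have : dot (a i) (b j) - dot (a i) (b j') = dot (a i) (b j1) - dot (a i) (b j0).
    by rewrite -!dotBr (subr0_eq diff).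
  move: neq; case: (bin i j iI jJ) => ->; case: (bin i j' iI j'J) => ->;
    case: (bin i j1 iI j1J) => ->; case: (bin i j0 iI j0J) => ->;
    move=> *; lra.
rewrite cardI cardJ expnS in leK *.
move: leKZ leXJ leZ leK; move: #|Z| #|K| #|J :\: X| #|X| (2 ^ d)%N => zz kk p x D.
(* The mixed terms are absorbed through [(zz - kk) * (p - x) >= 0]. *)
nia.
Qed.

(** A nonzero column serves as the first normal. One of its values 0 and 1 is taken by at least half
    of the rows, and a change of origin reduces the case of value 1 to that of value 0. *)
Lemma binary_system_bound (d : nat) : system_bound d.
Proof.
elim: d => [|d IH] S T I J a b sys.
  apply: leq_trans (system_card_le1 sys _) _ => // i j _ _.
  by rewrite /dot (flatmx0 (b j)^T) mulmx0 mxE.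
have [[j jJ bj]|b0] := pselect (exists2 j, j \in J & b j != 0); last first.
  apply: leq_trans (system_card_le1 sys _) _; last first.
    by rewrite muln_gt0 expn_gt0 addn1.
  move=> i j iI jJ; have [->|bj] := eqVneq (b j) 0; first exact: dot0r.
  by case: b0; exists j.
have [le|/ltnW gt] := leqP #|[set i in I | dot (a i) (b j) != 0]|
    #|[set i in I | dot (a i) (b j) == 0]|.
  exact: majority_system_bound IH sys bj le.
have [bin [i0 i0I ai0] [z zJ bz] rows cols] := sys.
have [s sI s1] : exists2 s, s \in I & dot (a s) (b j) = 1.
  have [s] : exists s, s \in [set i in I | dot (a i) (b j) != 0].
    apply/set0Pn; rewrite -card_gt0; apply: leq_trans gt.
    by apply/card_gt0P; exists i0; rewrite inE i0I ai0 dot0l eqxx.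
  rewrite inE => /andP[sI sj]; exists s => //.
  by case: (bin s j sI jJ) sj => // ->; rewrite eqxx.
(* Moving the origin to a s exchanges the two sides of the hyperplane. *)
pose a' i := a i - a s.
(* Columns with product 1 at [a s] would get products 0 and -1 after the shift, hence the sign. *)
pose b' y := (1 - dot (a s) (b y) *+ 2) *: b y.
have ab' i y : dot (a' i) (b' y) =
    (1 - dot (a s) (b y) *+ 2) * (dot (a i) (b y) - dot (a s) (b y)).
  by rewrite dotZr dotBl.
have sys' : binary_system I J a' b'.
  split.
  - move=> i y iI yJ; rewrite ab' /binary.
    by case: (bin i y iI yJ) => ->; case: (bin s y sI yJ) => ->;
      clear bz ai0; (left; lra) || (right; lra).
  - by exists s => //; rewrite /a' subrr.
  - by exists z => //; rewrite /b' bz scaler0.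
  - move=> i i' iI i'I E; apply: rows => // y yJ.
    by have := E y yJ; rewrite !ab'; case: (bin s y sI yJ) => ->; lra.
  - move=> y y' yJ y'J E; apply: cols => // i iI.
    (* The row [i0], formerly zero, recovers the value of the column at [a s] and thus its sign. *)
    have := E i0 i0I; have := E i iI.
    rewrite ![dot (b' _) _]dotC !ab' ai0 !dot0l ![dot (b _) _]dotC.
    by case: (bin s y sI yJ) => ->; case: (bin s y' sI y'J) => ->; lra.
apply: majority_system_bound IH sys' bj _.
have E i : i \in I -> (dot (a' i) (b j) == 0) = (dot (a i) (b j) != 0).
  move=> iI; rewrite /a' dotBl s1 subr_eq0.
  by case: (bin i j iI jJ) => ->; rewrite eqxx eq_sym ?oner_eq0 // eq_sym oner_eq0.
apply: leq_trans (leq_trans gt _); apply: subset_leq_card;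
  apply/fintype.subsetP => i; rewrite !inE => /andP[iI]; rewrite E // iI //.
by rewrite negbK.
Qed.

End Bound.

(** * From spanning sets to finite families *)

Section Spanning.
Variables (R : realType) (d : nat).
Implicit Types (A B : set 'rV[R]_d) (u v : 'rV[R]_d).

Lemma scalar_productE u v : scalar_product u v = dot u v.
Proof. by rewrite /dot mxE; apply: eq_bigr => i _; rewrite mxE. Qed.

Lemma dot_span_eq0 (s : seq 'rV[R]_d) u v :
  (forall a, a \in s -> dot a v = 0) -> u \in <<s>>%VS -> dot u v = 0.
Proof.
move=> sv us; rewrite (coord_span (X := in_tuple s) us) /dot mulmx_suml summxE.
apply: big1 => i _; rewrite -/(dot _ _) dotZl sv ?mulr0 //.
by rewrite mem_nth.
Qed.

(** Each standard basis vector needs only finitely many elements of [A]; concatenating these lists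
    gives a finite sequence whose orthogonal complement is zero. *)
Lemma spanning_seq A : linear_span A = setT ->
  exists2 s : seq 'rV[R]_d, (forall a, a \in s -> A a) &
    forall v, (forall a, a \in s -> dot a v = 0) -> v = 0.
Proof.
move=> hA; have [s sP] : exists s : 'I_d -> seq 'rV[R]_d, forall i,
    (forall a, a \in s i -> A a) /\ delta_mx 0 i \in <<s i>>%VS.
  apply: (@fin_all_exists _ _ (fun i t => (forall a, a \in t -> A a) /\
    delta_mx 0 i \in <<t>>%VS)) => i.
  have : linear_span A (delta_mx 0 i) by rewrite hA.
  by case=> t tA it; exists t; split.
exists (flatten [seq s i | i <- enum 'I_d]) => [a /flatten_mapP[i _]|v sv].
  exact: (proj1 (sP i)).
apply/rowP => i; rewrite mxE.
have : dot (delta_mx 0 i) v = 0.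
  apply: dot_span_eq0 (proj2 (sP i)) => a ai; apply: sv.
  by apply/flatten_mapP; exists i => //; rewrite mem_enum.
by rewrite /dot -rowE !mxE.
Qed.

(** A vector of [B] is determined by its 0/1 pattern on [s], and there are finitely many
    patterns. *)
Lemma finite_binary (s : seq 'rV[R]_d) B :
    (forall v, (forall a, a \in s -> dot a v = 0) -> v = 0) ->
    (forall a b, a \in s -> B b -> binary (dot a b)) ->
  finite_set B.
Proof.
move=> tot bin; pose f b := [ffun a : seq_sub s => dot (val a) b == 1].
have injf : {in B &, injective f}.
  move=> b b'; rewrite !inE => Bb Bb' /ffunP E; apply/eqP; rewrite -subr_eq0.
  apply/eqP/tot => a sa; have := E (SeqSub sa); rewrite !ffunE /= dotBr.
  case: (bin a b sa Bb) => ->; case: (bin a b' sa Bb') => ->;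
    by rewrite ?subrr // eqxx eq_sym oner_eq0.
by rewrite -(eq_finite_set (inj_card_eq injf)).
Qed.

End Spanning.

Local Open Scope classical_set_scope.
Local Open Scope ring_scope.

Theorem theorem1 (R : realType) (d : nat) (A B : set 'rV[R]_d)
    (hA : linear_span A = setT) (hB : linear_span B = setT)
    (hAB : forall a b : 'rV[R]_d, A a -> B b ->
       scalar_product a b = 0 \/ scalar_product a b = 1) :
  [/\ finite_set A, finite_set B &
      (#|` fset_set A| * #|` fset_set B| <= (d + 1) * 2 ^ d)%N].
Proof.
have bin a b : A a -> B b -> binary (dot a b).
  by move=> Aa Bb; rewrite -scalar_productE; apply: hAB.
have [s sA stot] := spanning_seq hA; have [t tB ttot] := spanning_seq hB.
have finB : finite_set B by apply: (finite_binary stot) => a b /sA; apply: bin.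
have finA : finite_set A.
  by apply: (finite_binary ttot) => b a /tB Bb Aa; rewrite dotC; apply: bin.
split=> //.
(* Adjoining 0 supplies the zero row and column of a binary system, keeps the products binary and
   cannot lower the cardinalities. *)
have finA0 : finite_set (0 |` A) by rewrite finite_setU; split=> //.
have finB0 : finite_set (0 |` B) by rewrite finite_setU; split=> //.
pose A0 := fset_set (0 |` A); pose B0 := fset_set (0 |` B).
have A0P u : (u \in A0) = (u \in 0 |` A) by rewrite in_fset_set.
have B0P u : (u \in B0) = (u \in 0 |` B) by rewrite in_fset_set.
have A0z : 0 \in A0 by rewrite A0P inE; left.
have B0z : 0 \in B0 by rewrite B0P inE; left.
have sub0 (C : set 'rV[R]_d) : finite_set (0 |` C) -> finite_set C ->
    (#|` fset_set C| <= #|` fset_set (0%R |` C)|)%N.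
  move=> fC0 fC; apply: fsubset_leq_card.
  by rewrite -fset_set_sub //; right.
apply: leq_trans (leq_mul (sub0 A finA0 finA) (sub0 B finB0 finB)) _.
rewrite !cardfE -!cardsT.
apply: (@binary_system_bound R d _ _ _ _ val val); split.
- move=> [a Aa] [b Bb] _ _ /=; move: Aa Bb; rewrite A0P B0P !inE.
  by case=> [->|Aa] [->|Bb]; rewrite ?dot0l ?dot0r; [left|left|left|apply: bin].
- by exists [` A0z]%fset.
- by exists [` B0z]%fset.
- move=> a a' _ _ E; apply/val_inj/eqP; rewrite -subr_eq0; apply/eqP/ttot => b tb.
  have bB0 : b \in B0 by rewrite B0P inE; right; apply: tB.
  by rewrite dotC dotBl (E [` bB0]%fset) ?inE // subrr.
- move=> b b' _ _ E; apply/val_inj/eqP; rewrite -subr_eq0; apply/eqP/stot => a sa.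
  have aA0 : a \in A0 by rewrite A0P inE; right; apply: sA.
  by rewrite dotC dotBl (E [` aA0]%fset) ?inE // subrr.
Qed.
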